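(* If an odd perfect number $N$ is given in Eulerian form $N = q^k n^2$ (with Euler prime $q$), then $q^k < \frac{2}{3} n^2$.
   Context: $\sigma(x)=\sum_{d\mid x} d$ denotes the sum of the positive divisors of the positive integer $x$. A positive integer $N$ is perfect if $\sigma(N) = 2N$. An odd perfect number $N$ is said to be given in Eulerian form if $N = q^k n^2$ where $q$ is a prime (called the Euler prime of $N$), $k$ and $n$ are positive integers, $q \equiv k \equiv 1 \pmod 4$ and $\gcd(q,n)=1$. *)

(* Defs.v *)
From mathcomp Require Import all_boot all_order all_algebra.

Set Implicit Arguments.
Unset Strict Implicit.
Unset Printing Implicit Defensive.

Definition sigma (x : nat) : nat := \sum_(d <- divisors x) d.

(* [divisors 0] is empty, so [sigma 0 = 2 * 0]: positivity must be required. *)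
Definition perfect (N : nat) : Prop := 0 < N /\ sigma N = 2 * N.

Record eulerian_form (N q k n : nat) : Prop := EulerianForm {
  eulerian_eq : N = q ^ k * n ^ 2;
  eulerian_prime : prime q;
  eulerian_k_gt0 : 0 < k;
  eulerian_n_gt0 : 0 < n;
  eulerian_q_mod4 : q = 1 %[mod 4];
  eulerian_k_mod4 : k = 1 %[mod 4];
  eulerian_coprime : coprime q n
}.

(* Main.v *)
Require Import Defs.
From mathcomp Require Import all_boot all_order all_algebra.
From mathcomp Require Import zify ring.

(** The idea: [sigma (q ^ k) = 1 %[mod q]] is prime to [q], so Gauss' lemma applied to
    [sigma (q ^ k) * sigma (n ^ 2) = 2 * q ^ k * n ^ 2] yields an index [m] with
    [sigma (n ^ 2) = m * q ^ k] and [m * sigma (q ^ k) = 2 * n ^ 2].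
    As [k] is odd, [sigma (q ^ k)] is even, hence [m] divides the odd number [n ^ 2].
    Once [m = 1] is excluded, [m >= 3], and [3 * q ^ k < m * sigma (q ^ k) = 2 * n ^ 2].

    Excluding [m = 1] ([index_neq1]) is the heart of the proof. Suppose
    [sigma (n ^ 2) = q ^ k], so that [sigma (q ^ k) = 2 * n ^ 2]. For a prime [p]
    dividing [n] exactly [a] times, [sigma (p ^ (2 * a))] divides
    [sigma (n ^ 2) = q ^ k], hence is a power [q ^ b]. The number
    [q ^ b - 1 = p + p ^ 2 + ... + p ^ (2 * a)] is divisible by [p] exactly once,
    so by lifting the exponent ([logn_geosum])
    [p] divides [q ^ (b * k.+1) - 1] exactly [1 + logn p k.+1] times. But
    [p ^ (2 * a)] divides [sigma (q ^ k)], which divides [q ^ k.+1 - 1] and thus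
    [q ^ (b * k.+1) - 1]. Therefore [2 * a <= 1 + logn p k.+1], whence
    [a <= logn p k.+1]. Running over all [p], [n] divides [k.+1]; as [n] is odd and
    [k.+1] even, [2 * n <= k.+1]. This makes [2 * n ^ 2 <= k.+1 ^ 2 %/ 2] far too
    small to equal [sigma (q ^ k) > 5 ^ k]. *)

(** * The sum of divisors *)

(** For coprime [m] and [n], each divisor of [m * n] splits uniquely as
    [d * e] with [d = gcdn (d * e) m] and [e = gcdn (d * e) n]. *)
Lemma sigma_mul m n : 0 < m -> 0 < n -> coprime m n ->
  sigma (m * n) = sigma m * sigma n.
Proof.
move=> m_gt0 n_gt0 co_mn.
have split_div: perm_eq (divisors (m * n))
    [seq d * e | d <- divisors m, e <- divisors n].
  apply: uniq_perm; first exact: divisors_uniq.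
    apply: allpairs_uniq; [exact: divisors_uniq | exact: divisors_uniq |].
    move=> [d e] [d' e'] /allpairsP[[x y] /= [xm yn [-> ->]]].
    move=> /allpairsP[[x' y'] /= [xm' yn' [-> ->]]] /= eq_xy.
    move: xm yn xm' yn'; rewrite -!dvdn_divisors // => xm yn xm' yn'.
    have gcdE u v : u %| m -> v %| n -> gcdn m (u * v) = u.
      move=> um vn; rewrite Gauss_gcdl ?(coprime_dvdr vn) //.
      by rewrite gcdnC; apply/gcdn_idPl.
    have eq_x: x = x' by rewrite -(gcdE x y) // eq_xy gcdE.
    move: eq_xy; rewrite -eq_x => /eqP; rewrite eqn_pmul2l ?(dvdn_gt0 m_gt0) //.
    by move/eqP=> ->.
  move=> d; rewrite -dvdn_divisors ?muln_gt0 ?m_gt0 //.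
  apply/idP/allpairsP=> [d_mn | [[x y] /= [xm yn ->]]]; last first.
    by apply: dvdn_mul; rewrite dvdn_divisors.
  exists (gcdn d m, gcdn d n); rewrite /= -!dvdn_divisors // !dvdn_gcdr.
  split=> //; apply/eqP; rewrite eqn_dvd; apply/andP; split.
    rewrite muln_gcdl dvdn_gcd dvdn_mulr //= muln_gcdr dvdn_gcd d_mn andbT.
    exact: dvdn_mull.
  rewrite Gauss_dvd ?dvdn_gcdl //.
  exact: coprime_dvdl (dvdn_gcdr _ _) (coprime_dvdr (dvdn_gcdr _ _) co_mn).
rewrite /sigma (perm_big _ split_div) big_allpairs_dep big_distrl /=.
by apply: eq_bigr => d _; rewrite big_distrr.
Qed.

Lemma sigma_pfactor p e : prime p -> sigma (p ^ e) = \sum_(i < e.+1) p ^ i.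
Proof.
move=> p_pr; have pe_gt0: 0 < p ^ e by rewrite expn_gt0 prime_gt0.
have divE: perm_eq (divisors (p ^ e)) [seq p ^ i | i <- index_iota 0 e.+1].
  apply: uniq_perm; first exact: divisors_uniq.
    rewrite map_inj_uniq ?iota_uniq // => i j /eqP.
    by rewrite eqn_exp2l ?prime_gt1 // => /eqP.
  move=> d; rewrite -dvdn_divisors //.
  apply/(dvdn_pfactor _ _ p_pr)/mapP=> [] [i i_le ->]; exists i => //.
    by rewrite mem_index_iota.
  by move: i_le; rewrite mem_index_iota.
by rewrite /sigma (perm_big _ divE) big_map big_mkord.
Qed.

Lemma sigma_gt0 n : 0 < n -> 0 < sigma n.
Proof. by move=> n_gt0; rewrite /sigma (big_rem _ (divisor1 n)). Qed.

Lemma sigma_pfactor_gt p e : prime p -> 0 < e -> p ^ e < sigma (p ^ e).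
Proof.
move=> p_pr; case: e => // e _; rewrite sigma_pfactor // big_ord_recr /=.
by rewrite -[X in X < _]add0n ltn_add2r big_ord_recl.
Qed.

Lemma sigma_pfactorS p e : prime p -> 0 < e ->
  sigma (p ^ e) = 1 + p * sigma (p ^ e.-1).
Proof.
case: e => // e p_pr _; rewrite !sigma_pfactor // big_ord_recl big_distrr /=.
by congr (_ + _); apply: eq_bigr => i _; rewrite expnS.
Qed.

Lemma coprime_sigma_pfactor p e : prime p -> coprime p (sigma (p ^ e)).
Proof.
case: e => [|e] p_pr; first by rewrite sigma_pfactor // big_ord1 coprimen1.
by rewrite sigma_pfactorS // /coprime addnC mulnC gcdnMDl gcdn1.
Qed.

Lemma odd_sigma_pfactor p e : prime p -> odd p -> odd (sigma (p ^ e)) = ~~ odd e.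
Proof.
move=> p_pr p_odd; elim: e => [|e IHe]; first by rewrite sigma_pfactor // big_ord1.
by rewrite sigma_pfactorS //= oddM p_odd IHe.
Qed.

(** * Lifting the exponent *)

(** The first two terms of [\sum_(j < m) 'C(m, j.+1) * a ^ j], the expansion of
    [((1 + a) ^ m - 1) / a]. *)
Lemma geosum_expand a m :
  exists z, \sum_(i < m) (1 + a) ^ i = m + a * 'C(m, 2) + a ^ 2 * z.
Proof.
have expE i : exists z, (1 + a) ^ i = 1 + a * i + a ^ 2 * z.
  elim: i => [|i [z IHi]]; first by exists 0; rewrite !muln0.
  by exists (i + z + a * z); rewrite expnS IHi; ring.
elim: m => [|m [z IHm]]; first by exists 0; rewrite big_ord0 bin0n !muln0.
have [w xE] := expE m; exists (z + w).
by rewrite big_ord_recr /= IHm xE binS bin1; ring.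
Qed.

Lemma geosum_mul x a b :
  \sum_(i < a * b) x ^ i = (\sum_(i < a) x ^ i) * \sum_(j < b) (x ^ a) ^ j.
Proof.
elim: b => [|b IHb]; first by rewrite muln0 !big_ord0 muln0.
rewrite mulnSr big_split_ord big_ord_recr /= IHb mulnDr; congr (_ + _).
by rewrite big_distrl /=; apply: eq_bigr => i _; rewrite -expnM -expnD addnC.
Qed.

(** Lifting the exponent for odd [p]. Modulo [p] the sum is [m], which settles
    [m] prime to [p]; a factor [p] of [m] contributes the sum with [p] terms, which is
    [p] modulo [p ^ 2] because [p] divides ['C(p, 2)]. *)
Lemma logn_geosum p x m : prime p -> odd p -> x = 1 %[mod p] -> 0 < x -> 0 < m ->
  logn p (\sum_(i < m) x ^ i) = logn p m.
Proof.
move=> p_pr p_odd; elim/ltn_ind: m x => m IHm x x1 x_gt0 m_gt0.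
have /dvdnP[y xE]: p %| x - 1 by rewrite -eqn_mod_dvd //; apply/eqP.
have {}xE: x = 1 + y * p by rewrite -xE subnKC.
have [/dvdnP[m' mE] | p'm] := boolP (p %| m); last first.
  have [z sumE] := geosum_expand (y * p) m.
  rewrite -xE in sumE; rewrite !logn_coprime ?prime_coprime //.
  rewrite sumE -addnA dvdn_addl //.
  by apply/dvdnP; exists (y * 'C(m, 2) + y ^ 2 * p * z); ring.
have m'_gt0: 0 < m' by move: m_gt0; rewrite mE muln_gt0 => /andP[].
rewrite mE mulnC geosum_mul.
have geo_gt0 t u : 0 < t -> 0 < u -> 0 < \sum_(i < u) t ^ i.
  by case: u => // u t_gt0 _; rewrite big_ord_recl.
have p_gt0 := prime_gt0 p_pr.
have x_p_gt0: 0 < x ^ p by rewrite expn_gt0 x_gt0.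
rewrite !lognM ?geo_gt0 // (IHm m') //; last first.
- by rewrite -modnXm x1 modnXm exp1n.
- by rewrite mE ltn_Pmulr // prime_gt1.
congr (_ + _); rewrite (logn_prime p p_pr) eqxx.
have [w binE]: exists w, 'C(p, 2) = w * p.
  apply/dvdnP; apply: prime_dvd_bin => //=.
  by rewrite ltn_neqAle prime_gt1 // andbT; apply: contraTneq p_odd => <-.
have [z sumE] := geosum_expand (y * p) p.
have {sumE}->: \sum_(i < p) x ^ i = p * (1 + p * (y * w + y ^ 2 * z)).
  by rewrite xE sumE binE; ring.
rewrite lognM // (logn_prime p p_pr) eqxx logn_coprime //.
by rewrite /coprime addnC mulnC gcdnMDl gcdn1.
Qed.

(** * The index is not 1 *)

(** The equation [sigma (p ^ e) = q ^ b] makes [q ^ b - 1] divisible by [p] only once,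
    so every further factor [p] of [q ^ (b * j) - 1], a multiple of [q ^ j - 1],
    has to come from the exponent [j]. *)
Lemma logn_sigma_pfactor_bound p q e b j : prime p -> odd p -> 0 < e ->
    0 < q -> 0 < j -> sigma (p ^ e) = q ^ b -> p ^ e %| (q ^ j).-1 ->
  e <= (logn p j).+1.
Proof.
move=> p_pr p_odd e_gt0 q_gt0 j_gt0 sE pe_dvd.
have p_gt0 := prime_gt0 p_pr; have sigS := sigma_pfactorS p e p_pr e_gt0.
have s_gt0: 0 < sigma (p ^ e.-1) by rewrite sigma_gt0 // expn_gt0 p_gt0.
have s_mod1: q ^ b = 1 %[mod p] by rewrite -sE sigS addnC mulnC modnMDl.
have s_gt1: 1 < q ^ b by rewrite -sE sigS -addn1 leq_add2l muln_gt0 p_gt0.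
have predE: ((q ^ b) ^ j).-1 = p * sigma (p ^ e.-1) * \sum_(i < j) (q ^ b) ^ i.
  by rewrite predn_exp -{1}sE sigS.
have geo_gt0: 0 < \sum_(i < j) (q ^ b) ^ i.
  by case: (j) j_gt0 => // j' _; rewrite big_ord_recl.
have: p ^ e %| ((q ^ b) ^ j).-1.
  by rewrite -expnM mulnC expnM predn_exp dvdn_mulr.
rewrite predE pfactor_dvdn // ?muln_gt0 ?p_gt0 ?s_gt0 ?geo_gt0 //.
rewrite !lognM ?muln_gt0 ?p_gt0 ?s_gt0 ?geo_gt0 // logn_geosum //;
  last exact: ltnW.
by rewrite (logn_prime p p_pr) eqxx logn_coprime // coprime_sigma_pfactor.
Qed.

Lemma sqrS_lt_2exp5 k : k.+1 ^ 2 < 2 * 5 ^ k.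
Proof.
elim: k => // k IHk; rewrite [5 ^ _]expnS mulnCA; apply: (@leq_ltn_trans (5 * k.+1 ^ 2)).
  by rewrite -!mulnn; nia.
by rewrite ltn_pmul2l.
Qed.

(** The [p]-adic valuations force [n] to divide [k.+1], so that [n ^ 2] is at most
    quadratic in [k], whereas [sigma (q ^ k)] grows exponentially. *)
Lemma index_neq1 q k n : prime q -> 4 < q -> odd k -> odd n ->
  sigma (q ^ k) = 2 * n ^ 2 -> sigma (n ^ 2) <> q ^ k.
Proof.
move=> q_pr q_gt4 k_odd n_odd sqE snE.
have n_gt0 := odd_gt0 n_odd; have q_gt0 := prime_gt0 q_pr.
have n2_gt0: 0 < n ^ 2 by rewrite expn_gt0 n_gt0.
have n_dvd: n %| k.+1.
  apply/(dvdn_partP _ n_gt0) => p; rewrite mem_primes => /and3P[p_pr _ p_n].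
  rewrite p_part pfactor_dvdn //.
  have p_odd: odd p by apply: dvdn_odd p_n n_odd.
  set a := logn p n; have a_gt0: 0 < a by rewrite -pfactor_dvdn.
  have [c co_pc nE] := pfactor_coprime p_pr n_gt0.
  have {}nE: n ^ 2 = c ^ 2 * p ^ (2 * a)
    by rewrite nE expnMn -expnM [a * 2]mulnC.
  have c2_gt0: 0 < c ^ 2 by move: n2_gt0; rewrite nE muln_gt0 => /andP[].
  have [b _ sE]: exists2 b, b <= k & sigma (p ^ (2 * a)) = q ^ b.
    apply/(dvdn_pfactor _ _ q_pr); rewrite -snE nE sigma_mul //.
    - exact: dvdn_mull.
    - by rewrite expn_gt0 prime_gt0.
    - by rewrite coprimeXl // coprimeXr // coprime_sym.
  suff: 2 * a <= (logn p k.+1).+1 by lia.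
  apply: (@logn_sigma_pfactor_bound p q (2 * a) b) => //; first by rewrite muln_gt0.
  apply: (@dvdn_trans (n ^ 2)); first by rewrite nE dvdn_mull.
  by rewrite predn_exp -sigma_pfactor // sqE mulnA dvdn_mull.
have le_n: 2 * n <= k.+1.
  apply: dvdn_leq => //; rewrite Gauss_dvd ?coprime2n // n_dvd andbT dvdn2 /=.
  by rewrite k_odd.
have := sigma_pfactor_gt q k q_pr (odd_gt0 k_odd).
have := sqrS_lt_2exp5 k; have: 5 ^ k <= q ^ k by rewrite leq_exp2r // odd_gt0.
rewrite sqE; move: (5 ^ k) (q ^ k) => u v; rewrite -!mulnn; nia.
Qed.

(** * The bound *)

Theorem corollary2p1 (N q k n : nat)
    (N_odd : odd N) (N_perfect : perfect N)
    (N_euler : eulerian_form N q k n) :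
  (((q ^ k)%N%:R : rat) < 2%:R / 3%:R * (n ^ 2)%N%:R)%R.
Proof.
case: N_euler N_perfect N_odd => -> q_pr k_gt0 n_gt0 q1 k1 co_qn [_].
rewrite oddM !oddX (gtn_eqF k_gt0) /= => perf /andP[q_odd n_odd].
have k_odd: odd k by lia.
have q_gt4: 4 < q by have := prime_gt1 q_pr; lia.
have qk_gt0: 0 < q ^ k by rewrite expn_gt0 prime_gt0.
have n2_gt0: 0 < n ^ 2 by rewrite expn_gt0 n_gt0.
rewrite sigma_mul // ?coprimeXl ?coprimeXr // in perf.
have /dvdnP[m snE]: q ^ k %| sigma (n ^ 2).
  rewrite -(@Gauss_dvdr _ (sigma (q ^ k))) ?coprimeXl ?coprime_sigma_pfactor //.
  by rewrite perf mulnCA dvdn_mulr.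
have sqE: m * sigma (q ^ k) = 2 * n ^ 2.
  apply/eqP; rewrite -(eqn_pmul2l qk_gt0) [X in _ == X]mulnCA -perf snE.
  by apply/eqP; ring.
have m_odd: odd m.
  have /dvdnP[s sE]: 2 %| sigma (q ^ k) by rewrite dvdn2 odd_sigma_pfactor // k_odd.
  have n2E: m * s = n ^ 2 by move: sqE; rewrite sE; lia.
  by have := oddX n 2; rewrite -n2E oddM n_odd /= => /andP[].
have m_neq1: m <> 1.
  move=> m1; move: sqE snE; rewrite m1 !mul1n => sqE.
  exact: index_neq1.
have m_ge3: 3 <= m by lia.
have lt_nat: q ^ k * 3 < 2 * n ^ 2.
  rewrite -sqE mulnC; apply: (@leq_trans (3 * sigma (q ^ k))).
    by rewrite ltn_pmul2l // sigma_pfactor_gt.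
  by rewrite leq_mul2r m_ge3 orbT.
rewrite GRing.mulrAC Num.Theory.ltr_pdivlMr ?Num.Theory.ltr0n //.
by rewrite -!GRing.natrM Num.Theory.ltr_nat.
Qed.
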